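(* Let $\mathcal{A}$ be a symmetric real tensor of order $a$ in $\mathbb{R}^{(n+1)\times\dots\times(n+1)}$ with $\mathcal{A}_{n+1\,\dots\,n+1}\ne 0$, let $\tilde{\mathcal{A}}(x)\in\mathbb{R}[x_1,\dots,x_n]$ be its associated dehomogenized polynomial, let $\Psi\in\mathbb{R}[x_1,\dots,x_n]$ be a sum of squares polynomial, and let $X=\{x\in\mathbb{R}^n\mid 1-\|x\|^2\ge 0\}$. Define the sequence $z_{\mathcal{A}}=\big(\langle\tilde{\mathcal{A}}(x),x^\alpha\rangle_a\big)_{\alpha\in\mathbb{N}^n_a}$ and suppose that $z_{\mathcal{A}}$ is in the relative interior of the truncated moment cone $$K=\Big\{\Big(\int_X x^\alpha\,d\mu\Big)_{\alpha\in\mathbb{N}^n_a}\ \Big|\ \mu\in\mathcal{M}_+(X)\Big\}.$$ Then the supremum in $$\sup_{\lambda\in\mathbb{R}^{\mathbb{N}^n_a}}\Big\{\Big\langle\tilde{\mathcal{A}}(x),\sum_{\alpha\in\mathbb{N}^n_a}\lambda_\alpha x^\alpha\Big\rangle_a\ :\ \Psi-\sum_{\alpha\in\mathbb{N}^n_a}\lambda_\alpha x^\alpha\ge 0\text{ on }X\Big\}$$ is attained, and, for every integer $t\ge\max\{1,\lceil a/2\rceil,\lceil\deg(\Psi)/2\rceil\}$, the supremum in $$\sup_{\lambda\in\mathbb{R}^{\mathbb{N}^n_a}}\Big\{\Big\langle\tilde{\mathcal{A}}(x),\sum_{\alpha\in\mathbb{N}^n_a}\lambda_\alpha x^\alpha\Big\rangle_a\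 :\ \Psi-\sum_{\alpha\in\mathbb{N}^n_a}\lambda_\alpha x^\alpha=\sigma_0+\sigma_1(1-\|x\|^2),\ \sigma_0\in\Sigma[x]_{2t},\ \sigma_1\in\Sigma[x]_{2(t-1)}\Big\}$$ is attained.
   Context: $\mathbb{N}^n_a=\{\alpha\in\mathbb{N}^n:|\alpha|\le a\}$. A tensor is symmetric if it is invariant under permutation of its indices. The associated polynomial is $\tilde{\mathcal{A}}(x)=\sum_{j_1,\dots,j_a=1}^{n+1}\mathcal{A}_{j_1\dots j_a}x_{j_1}\cdots x_{j_a}$ evaluated at $x_{n+1}=1$; it has degree at most $a$ in $x_1,\dots,x_n$. For polynomials $f=\sum f_\alpha x^\alpha$, $g=\sum g_\alpha x^\alpha$ of degree at most $a$, the apolar product is $$\langle f,g\rangle_a=\sum_{\alpha\in\mathbb{N}^n_a}\binom{a}{\alpha}^{-1}f_\alpha g_\alpha,\qquad\binom{a}{\alpha}=\frac{a!}{(a-|\alpha|)!\,\alpha_1!\cdots\alpha_n!}.$$ $\mathcal{M}_+(X)$ is the set of finite nonnegative Borel measures supported on $X$; relative interior means interior within the affine hull; $\Sigma[x]_{2t}$ is the set of sums of squares of polynomials having degree at most $2t$. The first program is the dual of the generalized moment problem $\inf\{\int_X\Psi\,d\mu:\int_X x^\alpha d\mu=\langle\tilde{\mathcal{A}}(x),x^\alpha\rangle_a,\ \alpha\in\mathbb{N}^n_a,\ \mu\in\mathcal{M}_+(X)\}$ associated with positive symmetric tensor decomposition; the second is its order-$t$ sum-of-squares strengthening. *)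

(* Defs.v *)
From HB Require Import structures.
From mathcomp Require Import all_boot all_order all_algebra all_fingroup.
From mathcomp Require Import -(notations) mpoly.
From mathcomp Require Import all_classical all_reals all_analysis.

Set Implicit Arguments.
Unset Strict Implicit.
Unset Printing Implicit Defensive.

Import Order.TTheory GRing.Theory Num.Theory.
Import numFieldNormedType.Exports.

Local Open Scope classical_set_scope.
Local Open Scope ring_scope.

(* The notations of mpoly.v clash with those of MathComp-Analysis, so only its
   names are imported: [mpoly n R] is the type {mpoly R[n]} of polynomials over
   R in n variables, [multinom n] the type of exponents, [mnm1 i] the exponent
   of the i-th variable and [bmultinom n b] the finite type of the exponents
   alpha with |alpha| < b. *)

Notation expn_le n a := (bmultinom n a.+1).

Definition monom (R : realType) (n : nat) (m : multinom n) : mpoly n R :=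
  mpolyX R m.

Definition var (R : realType) (n : nat) (i : 'I_n) : mpoly n R :=
  monom R (mnm1 i).

Definition peval (R : realType) (n : nat) (p : mpoly n R) (x : 'rV[R]_n) : R :=
  meval (x ord0) p.

(* [mmeasure (@mdeg n) p], known as msize p, is 1 + the total degree of p if
   p != 0, and 0 otherwise; so here the zero polynomial has degree 0. *)
Definition pdeg (R : realType) (n : nat) (p : mpoly n R) : nat :=
  (mmeasure (@mdeg n) p).-1.

(* Tensors of order a in R^((n+1) x ... x (n+1)), with indices in
   {0, ..., n}: the distinguished last index n+1 is [ord_max]. *)
Definition tensor (R : realType) (n a : nat) : Type :=
  {ffun 'I_a -> 'I_n.+1} -> R.

Definition symmetric_tensor (R : realType) (n a : nat) (A : tensor R n a) :=
  forall (s : 'S_a) (j : {ffun 'I_a -> 'I_n.+1}), A [ffun k => j (s k)] = A j.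

(* The coordinates of (x_1, ..., x_n, 1) *)
Definition dehom_var (R : realType) (n : nat) (i : 'I_n.+1) : mpoly n R :=
  if unlift ord_max i is Some k then var R k else 1.

Definition tensor_poly (R : realType) (n a : nat) (A : tensor R n a) :
    mpoly n R :=
  \sum_(j : {ffun 'I_a -> 'I_n.+1}) A j *: \prod_(k < a) dehom_var R (j k).

Definition multinomial (R : realType) (n a : nat) (alpha : expn_le n a) : R :=
  a`!%:R / ((a - mdeg alpha)`! * \prod_(i < n) (alpha i)`!)%:R.

Definition apolar (R : realType) (n a : nat) (f g : mpoly n R) : R :=
  \sum_(alpha : expn_le n a)
    (multinomial R alpha)^-1 * mcoeff alpha f * mcoeff alpha g.

Definition poly_of (R : realType) (n a : nat) (lambda : expn_le n a -> R) :
    mpoly n R :=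
  \sum_(alpha : expn_le n a) lambda alpha *: monom R alpha.

Definition is_sos (R : realType) (n : nat) (p : mpoly n R) : Prop :=
  exists s : seq (mpoly n R), p = \sum_(q <- s) q ^+ 2.

Definition sos_le (R : realType) (n d : nat) (p : mpoly n R) : Prop :=
  is_sos p /\ (pdeg p <= d)%N.

(* The norm that the library puts on 'rV[R]_n is the sup norm, so the
   Euclidean one is spelled out. *)
Definition unit_ball (R : realType) (n : nat) : set 'rV[R]_n :=
  [set x | 1 - \sum_(i < n) x ord0 i ^+ 2 >= 0].

Definition ball_poly (R : realType) (n : nat) : mpoly n R :=
  1 - \sum_(i < n) var R i ^+ 2.

Definition borel_rV (R : realType) (n : nat) :=
  g_sigma_algebraType (@open 'rV[R]_n).

(* For a closed X, a measure is supported on X iff it vanishes on the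
   complement of X. *)
Definition moment_cone (R : realType) (n a : nat) (X : set 'rV[R]_n) :
    set (expn_le n a -> R) :=
  [set y | exists mu : {finite_measure set (borel_rV R n) -> \bar R},
     mu (~` X) = 0%E /\
     forall alpha : expn_le n a, y alpha =
       \int[mu]_(x in (X : set (borel_rV R n))) peval (monom R alpha) x].

Definition affine_hull (R : realType) (V : lmodType R) (A : set V) : set V :=
  [set v | exists (k : nat) (c : 'I_k -> R) (x : 'I_k -> V),
     [/\ forall i, A (x i), \sum_i c i = 1 & v = \sum_i c i *: x i]].

Definition relative_interior (R : realType) (I : finType)
    (A : set (I -> R^o)) : set (I -> R^o) :=
  [set z | affine_hull A z /\
     \forall y \near (z : {ptws I -> R}), affine_hull A y -> A y].

Definition sup_attained (R : realType) (T : Type) (F : set T) (f : T -> R) :=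
  exists2 l, F l & (f l)%:E = ereal_sup [set (f l')%:E | l' in F].

(* Main.v *)
(* Pairing with z is a linear form L on the coefficients lambda.  By
   interpolation, the point evaluations on the ball of radius 1/2 span the dual
   of the polynomials of bounded degree; hence the moment cone K has full
   affine hull and the relative interior is the interior.  So z + r e lies in K
   for e = +-(a unit vector) and some r > 0.  If p_lambda <= M on X, then
   integrating p_lambda against a measure with moments z + r e gives
   L(lambda) + r <lambda, e> <= M (z + r e)_0, so the feasible lambda with
   L(lambda) >= 0 are bounded, and lambda = 0 is one of them.  The first
   supremum is therefore the maximum of L on a compact set.  In the
   relaxation, sigma_0 and sigma_1 are sums of a fixed number of squares
   (Caratheodory) of polynomials of degree at most t and t - 1 (leading terms
   do not cancel); their values on the ball of radius 1/2 are bounded in terms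
   of Psi - p_lambda, since 1 - |x|^2 >= 3/4 there, and so are their
   coefficients, by interpolation again.  So (lambda, coefficients of the
   squares) ranges over a compact set as well. *)
Require Import Defs.
From HB Require Import structures.
From mathcomp Require Import all_boot all_order all_algebra all_fingroup.
From mathcomp Require Import -(notations) mpoly.
From mathcomp Require Import all_classical all_reals all_analysis.
From mathcomp Require Import measurable_realfun.
From mathcomp Require Import lra zify.

Import Order.TTheory GRing.Theory Num.Theory.
Import numFieldNormedType.Exports.

Local Open Scope classical_set_scope.
Local Open Scope ring_scope.

(** * Recovering coefficients from values *)

(** Distinct nodes make the Vandermonde matrix invertible; column [j] of its inverse reads off the
    coefficient of degree [j] from the values at the nodes. *)
Lemma vandermonde_dual (F : fieldType) (d : nat) (s : 'I_d -> F) :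
  injective s ->
  exists c : 'I_d -> 'I_d -> F,
    forall i j : 'I_d, \sum_k c j k * s k ^+ i = (i == j)%:R.
Proof.
move=> sI; set V := Vandermonde d (\row_k s k).
have Vu : V \in unitmx.
  rewrite unitmxE det_Vandermonde unitfE.
  apply/prodf_neq0 => i _; apply/prodf_neq0 => j ij.
  rewrite !mxE subr_eq0; apply: contraTN ij => /eqP/sI ->.
  by rewrite ltnn.
exists (fun j k => invmx V k j) => i j.
have /matrixP/(_ i j) := mulmxV Vu; rewrite !mxE => <-.
by apply: eq_bigr => k _; rewrite !mxE mulrC.
Qed.

Lemma peval_sum (R : realType) (n : nat) (I : Type) (r : seq I) (P : pred I)
    (f : I -> mpoly n R) (x : 'rV[R]_n) :
  peval (\sum_(i <- r | P i) f i) x = \sum_(i <- r | P i) peval (f i) x.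
Proof. exact: raddf_sum. Qed.

Lemma pevalZ (R : realType) (n : nat) c (p : mpoly n R) x :
  peval (c *: p) x = c * peval p x.
Proof. exact: mevalZ. Qed.

Lemma pevalB (R : realType) (n : nat) (p q : mpoly n R) x :
  peval (p - q) x = peval p x - peval q x.
Proof. exact: mevalB. Qed.

Lemma pevalD (R : realType) (n : nat) (p q : mpoly n R) x :
  peval (p + q) x = peval p x + peval q x.
Proof. exact: mevalD. Qed.

Lemma pevalM (R : realType) (n : nat) (p q : mpoly n R) x :
  peval (p * q) x = peval p x * peval q x.
Proof. exact: mevalM. Qed.

Lemma peval_sumsq (R : realType) (n : nat) (I : Type) (r : seq I)
    (q : I -> mpoly n R) x :
  peval (\sum_(i <- r) q i ^+ 2) x = \sum_(i <- r) peval (q i) x ^+ 2.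
Proof.
by rewrite peval_sum; apply: eq_bigr => i _; rewrite !expr2 pevalM.
Qed.

Lemma pevalE (R : realType) (n : nat) (p : mpoly n R) x :
  peval p x = \sum_(m <- msupp p) mcoeff m p * peval (monom R m) x.
Proof.
by rewrite {1}[p]mpolyE peval_sum; apply: eq_bigr => m _; rewrite pevalZ.
Qed.

(* The nodes form a grid {0, e, ..., d e}^n, and c is a product of univariate
   dual bases of the monomials. *)
Lemma interpolation (R : realType) (n d : nat) :
  exists (K : finType) (x : K -> 'rV[R]_n) (c : multinom n -> K -> R),
    (forall k, \sum_i x k ord0 i ^+ 2 <= 4^-1) /\
    forall (p : mpoly n R) (al : multinom n),
      (mmeasure (@mdeg n) p <= d.+1)%N -> (mdeg al <= d)%N ->
      mcoeff al p = \sum_k c al k * peval p (x k).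
Proof.
(* Node coordinates are at most [d * e], hence at most 1/(2(n+1)), and n squares of that size sum to
   at most 1/4. *)
pose e : R := (2 * (d.+1 * n.+1)%:R)^-1.
have e_gt0 : 0 < e by rewrite invr_gt0 mulr_gt0 // ltr0n.
pose s (k : 'I_d.+1) : R := k%:R * e.
have sI : injective s.
  move=> i j /(mulIf (lt0r_neq0 e_gt0)) /eqP; rewrite eqr_nat => /eqP.
  exact: val_inj.
have [c cP] := vandermonde_dual R _ s sI.
exists {ffun 'I_n -> 'I_d.+1}, (fun k : {ffun _} => \row_i s (k i)),
  (fun al (k : {ffun _}) => \prod_i c (inord (al i)) (k i)); split.
  move=> k; under eq_bigr do rewrite mxE.
  have sb (j : 'I_d.+1) : s j ^+ 2 <= (4 * n.+1%:R)^-1.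
    have s_le : s j <= (2 * n.+1%:R)^-1.
      rewrite /s /e natrM mulrCA invfM mulrA ler_piMl ?invr_ge0 //.
      by rewrite ler_pdivrMr ?ltr0n // mul1r ler_nat ltnW.
    have s_ge : 0 <= s j by rewrite mulr_ge0 // ltW.
    apply: le_trans (_ : (2 * n.+1%:R)^-1 ^+ 2 <= _).
      by rewrite lerXn2r // nnegrE invr_ge0 mulr_ge0.
    rewrite exprVn lef_pV2 ?posrE ?mulr_gt0 ?exprn_gt0 ?mulr_gt0 ?ltr0n //.
    have : 1 <= n.+1%:R :> R by rewrite ler1n.
    nra.
  apply: le_trans (ler_sum _ (fun i _ => sb (k i))) _.
  rewrite sumr_const card_ord -[leLHS]mulr_natl invfM mulrCA ler_piMr ?invr_ge0 //.
  by rewrite ler_pdivrMr ?ltr0n // mul1r ler_nat.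
move=> p al pd ald.
have mn_le (m : multinom n) i : (mdeg m <= d)%N -> (m i < d.+1)%N.
  by rewrite mdegE (bigD1 i) //= ltnS; apply: leq_trans (leq_addr _ _).
under eq_bigr do rewrite pevalE mulr_sumr.
rewrite exchange_big /= [in LHS](mpolyE p) raddf_sum /= !big_seq.
apply: eq_bigr => m /msize_mdeg_lt mp; rewrite mcoeffZ mcoeffX.
have md : (mdeg m <= d)%N by rewrite -ltnS (leq_trans mp).
under eq_bigr do rewrite mulrCA /peval /monom mevalX -big_split.
rewrite -mulr_sumr; congr (_ * _).
under eq_bigr do under eq_bigr do rewrite /= mxE.
(* The sum over the grid factors into one sum per coordinate, each a Kronecker delta by [cP]. *)
rewrite -(bigA_distr_bigA (fun i j => c (inord (al i)) j * s j ^+ m i)) /=.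
under eq_bigr => i _.
  have /= := cP (inord (m i)) (inord (al i)).
  rewrite inordK ?mn_le // => ->.
  rewrite -val_eqE /= !inordK ?mn_le //.
  over.
case: eqVneq => [->|mal]; first by rewrite big1 // => i _; rewrite eqxx.
have [i ne] : exists i, m i != al i.
  apply/existsP; apply: contraNT mal; rewrite negb_exists => /forallP h.
  by apply/eqP/mnmP => i; apply/eqP; have := h i; rewrite negbK.
by rewrite (bigD1 i) //= (negPf ne) mul0r.
Qed.

(** * Sums of squares: degrees and number of squares *)

(** Real squares cannot cancel at the top: if M is the largest leading exponent, 2M survives in the
    sum. The monomial order refines the degree, so M has the largest degree as well. *)
Lemma msize_sumsq (R : realType) (n m t : nat) (f : 'I_m -> mpoly n R) :
  (mmeasure (@mdeg n) (\sum_i f i ^+ 2) <= (2 * t).+1)%N ->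
  forall i, (mmeasure (@mdeg n) (f i) <= t.+1)%N.
Proof.
move=> ft i; rewrite leqNgt; apply/negP => fi.
have fi0 : f i != 0 by apply: contraTneq fi => ->; rewrite mmeasure0.
have [j _ jmax] := @Order.TotalTheory.arg_maxP _ _ _ i xpredT (fun k => mlead (f k)) isT.
(* The coefficient at 2M is a sum of squares, one of which is nonzero. *)
set M := mlead (f j) in jmax.
have tM : (t < mdeg M)%N.
  have := lemc_mdeg (jmax i isT); apply: leq_trans.
  by rewrite -ltnS mlead_deg.
have fj0 : f j != 0.
  by apply: contraTneq tM => fj0; rewrite /M fj0 mlead0 mdeg0.
have sqE k : mcoeff (mnm_add M M) (f k ^+ 2) = mcoeff M (f k) ^+ 2.
  by rewrite !expr2; apply: mleadcMW; exact: jmax.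
have : mnm_add M M \in msupp (\sum_i f i ^+ 2).
  rewrite mcoeff_msupp raddf_sum /= (bigD1 j) //=.
  under eq_bigr do rewrite sqE.
  rewrite sqE gt_eqF // ltr_wpDr //.
    by apply: sumr_ge0 => k _; rewrite sqr_ge0.
  by rewrite exprn_even_gt0 //= mleadc_eq0.
move=> /msize_mdeg_lt; rewrite mdegD; lia.
Qed.

Lemma msize_mul (R : idomainType) (n : nat) (p q : mpoly n R) :
  (mmeasure (@mdeg n) (p * q) <=
   (mmeasure (@mdeg n) p + mmeasure (@mdeg n) q).-1)%N.
Proof.
have [->|p0] := eqVneq p 0; first by rewrite mul0r mmeasure0.
have [->|q0] := eqVneq q 0; first by rewrite mulr0 mmeasure0.
by rewrite msizeM.
Qed.

(** The squares lie in the space of polynomials of degree at most 2t, of dimension [D]. More than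
    [D] of them are linearly dependent, and a dependency lets one square be removed, the new weights
    being absorbed through their square roots. *)
Lemma sumsq_caratheodory (R : realType) (n t m : nat)
    (f : 'I_m -> mpoly n R) :
  (forall i, mmeasure (@mdeg n) (f i) <= t.+1)%N ->
  exists g : 'I_#|{: expn_le n (2 * t)}| -> mpoly n R,
    (forall i, mmeasure (@mdeg n) (g i) <= t.+1)%N /\
    \sum_i f i ^+ 2 = \sum_i g i ^+ 2.
Proof.
set D := #|_|; elim: m f => [|m IHm] f ft.
  exists (fun=> 0); split=> [i|]; first by rewrite mmeasure0.
  by rewrite big_ord0 big1 // => i _; rewrite expr0n.
have [mD|Dm] := leqP m.+1 D.
  (* A family of at most [D] polynomials is padded with zeros. *)
  pose g (i : 'I_D) := if insub (i : nat) is Some j then f j else 0.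
  exists g; split=> [i|].
    by rewrite /g; case: insubP => [j _ _|_]; rewrite ?ft ?mmeasure0.
  pose h (i : nat) : mpoly n R := (if insub i is Some j then f j else 0) ^+ 2.
  have -> : \sum_i f i ^+ 2 = \sum_(i < m.+1) h i.
    apply: eq_bigr => i _; rewrite /h insubT //= => p.
    by congr (f _ ^+ 2); apply: val_inj.
  have -> : \sum_i g i ^+ 2 = \sum_(i < D) h i by [].
  rewrite -!(big_mkord xpredT h) (big_cat_nat (n := m.+1) (p := D)) //=.
  rewrite [X in _ + X]big_nat_cond [X in _ + X]big1 ?addr0 //.
  move=> i /andP[/andP[mi _] _]; rewrite /h insubF ?expr0n //.
  by rewrite ltnNge mi.
pose V := \matrix_(i < m.+1, j < D)
  mcoeff (enum_val j : expn_le n (2 * t)) (f i ^+ 2).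
have : kermx V != 0.
  rewrite kermx_eq0 /row_free; apply: contraTneq Dm => <-.
  by rewrite -leqNgt rank_leq_col.
move=> /rowV0Pn[u0 /sub_kermxP u0V u0n0].
(* Up to sign the relation has a positive entry, so its largest entry is positive. *)
have [u [uV [i0 ui0]]] : exists u : 'rV_m.+1, u *m V = 0 /\ exists i, 0 < u ord0 i.
  have [i ui] : exists i, u0 ord0 i != 0.
    apply/existsP; apply: contraNT u0n0; rewrite negb_exists => /forallP h.
    by apply/eqP/rowP => i; rewrite mxE; apply/eqP; have := h i; rewrite negbK.
  have [ui0|ui0|ui0] := ltgtP (u0 ord0 i) 0; last by rewrite ui0 eqxx in ui.
    exists (- u0); split; first by rewrite mulNmx u0V oppr0.
    by exists i; rewrite mxE oppr_gt0.
  by exists u0; split => //; exists i.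
have uf : \sum_i u ord0 i *: f i ^+ 2 = 0.
  apply/mpolyP => al; rewrite mcoeff0 raddf_sum /=.
  have [al2t|al2t] := ltnP (mdeg al) (2 * t).+1.
    have /rowP/(_ (enum_rank (BMultinom al2t))) := uV.
    rewrite !mxE => uV0; apply: etrans uV0; apply: eq_bigr => i _.
    by rewrite mcoeffZ mxE enum_rankK.
  (* No square has a coefficient beyond degree 2t, so the columns of [V] capture the whole
     relation. *)
  apply: big1 => i _; rewrite mcoeffZ (memN_msupp_eq0 (msize_mdeg_ge _)) ?mulr0 //.
  apply: leq_trans al2t; rewrite expr2; apply: leq_trans (msize_mul _ _ _ _) _.
  by move: (mmeasure _ (f i)) (ft i) => s st; lia.
(* Subtracting 1 / u_k times the relation kills the k-th square and keeps the
   other weights 1 - u_i / u_k nonnegative. *)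
have [k _ kmax] := @Order.TotalTheory.arg_maxP _ _ _ i0 xpredT (fun i => u ord0 i) isT.
have uk : 0 < u ord0 k by apply: lt_le_trans ui0 (kmax _ isT).
have c_ge0 i : 0 <= 1 - u ord0 i / u ord0 k.
  by rewrite subr_ge0 ler_pdivrMr // mul1r; exact: kmax.
have [i|g [gt fg]] := IHm (fun i => Num.sqrt (1 - u ord0 (lift k i) / u ord0 k)
  *: f (lift k i)).
  exact: leq_trans (msizeZ_le _ _) (ft _).
exists g; split => //; rewrite -fg.
have -> : \sum_i f i ^+ 2 = \sum_i (1 - u ord0 i / u ord0 k) *: f i ^+ 2.
  under [RHS]eq_bigr do rewrite scalerBl scale1r mulrC -scalerA.
  by rewrite sumrB -scaler_sumr uf scaler0 subr0.
rewrite (bigD1_ord k) //= divff ?gt_eqF // subrr scale0r add0r.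
by apply: eq_bigr => i _; rewrite exprZn sqr_sqrtr.
Qed.

(** * Polynomials on the unit ball: continuity, boundedness, integrability *)

Lemma peval_continuous (R : realType) (n : nat) (p : mpoly n R) :
  continuous (peval p).
Proof.
have -> : peval p = fun x => \sum_(m <- msupp p)
    mcoeff m p * \prod_i x ord0 i ^+ m i.
  by apply/funext => x; exact: mevalE.
apply: continuous_big => [|m _]; first exact: add_continuous.
have mc : continuous (fun x : 'rV[R]_n => \prod_i x ord0 i ^+ m i).
  apply: continuous_big => [|i _]; first exact: mul_continuous.
  move=> x; apply: (@continuous_comp _ _ _ (fun y : 'rV[R]_n => y ord0 i)
    (fun z => z ^+ m i)); first exact: coord_continuous.
  exact: exprn_continuous.
by move=> x; exact: (cvgM (@cvg_cst _ _ _ _ _) (mc x)).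
Qed.

Lemma peval_ball_poly (R : realType) (n : nat) (x : 'rV[R]_n) :
  peval (ball_poly R n) x = 1 - \sum_(i < n) x ord0 i ^+ 2.
Proof.
rewrite /ball_poly /peval mevalB meval1; congr (_ - _).
rewrite -[LHS]/(peval _ x) peval_sum; apply: eq_bigr => i _.
by rewrite /peval expr2 mevalM mevalXU.
Qed.

Lemma closed_unit_ball (R : realType) (n : nat) : closed (@unit_ball R n).
Proof.
have -> : @unit_ball R n = peval (ball_poly R n) @^-1` [set r | 0 <= r].
  by apply/seteqP; split=> x /=; rewrite peval_ball_poly.
by apply: closed_comp => [x _|]; [exact: peval_continuous|exact: closed_ge].
Qed.

Lemma compact_unit_ball (R : realType) (n : nat) : compact (@unit_ball R n).
Proof.
apply: (subclosed_compact (@closed_unit_ball R n)).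
  exact: (rV_compact (fun=> @segment_compact R (-1) 1)).
move=> x xX i; rewrite /= in_itv /= -ler_norml -(ler_pXn2r (n := 2)) ?nnegrE //.
rewrite real_normK ?num_real // expr1n.
move: xX; rewrite /unit_ball /= subr_ge0; apply: le_trans.
by rewrite (bigD1 i) //= lerDl sumr_ge0 // => j _; rewrite sqr_ge0.
Qed.

Lemma peval_bounded (R : realType) (n : nat) (p : mpoly n R) :
  exists2 M, 0 <= M & forall x, unit_ball x -> `|peval p x| <= M.
Proof.
have : compact (peval p @` @unit_ball R n).
  apply: continuous_compact (@compact_unit_ball R n).
  by apply: continuous_subspaceT; exact: peval_continuous.
move=> /compact_bounded/ex_strict_bound_gt0[M M0 Mp].
by exists M => [|x xX]; [exact: ltW|apply/ltW/Mp; exists x].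
Qed.

Lemma measurable_unit_ball (R : realType) (n : nat) :
  measurable (@unit_ball R n : set (borel_rV R n)).
Proof.
rewrite -[X in measurable X]setCK; apply: measurableC.
by apply: sub_sigma_algebra; rewrite /= openC; exact: closed_unit_ball.
Qed.

Lemma measurable_peval (R : realType) (n : nat) (p : mpoly n R)
    (D : set (borel_rV R n)) :
  measurable_fun D (peval p : borel_rV R n -> R).
Proof.
move=> mD; apply: (measurability _ (measurable_realfun.RGenOpens.measurableE R)) => //.
move=> _ [_ [a [b ->] <-]]; apply: measurableI => //.
have op : open (peval p @^-1` `]a, b[%classic).
  apply: open_comp; last exact: interval_open.
  by move=> x _; exact: peval_continuous.
exact: sub_sigma_algebra op.
Qed.

Lemma peval_integrable (R : realType) (n : nat) (p : mpoly n R)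
    (mu : {finite_measure set (borel_rV R n) -> \bar R}) :
  mu.-integrable (@unit_ball R n : set (borel_rV R n))
    (EFin \o (peval p : borel_rV R n -> R)).
Proof.
apply: measurable_bounded_integrable.
- exact: measurable_unit_ball.
- rewrite (le_lt_trans (le_measure _ _ _ (@subsetT _ _))) ?inE //.
  + exact: measurable_unit_ball.
  + by rewrite ltey_eq fin_num_measure.
- exact: measurable_peval.
- have [M _ pM] := peval_bounded R n p.
  by exists M; split; rewrite ?num_real // => N MN x xX; apply: le_trans (ltW MN); exact: pM.
Qed.

(** * The moment cone and its relative interior *)

(** The pointwise bound is integrated against a representing measure; [y bm0], the moment of
    exponent 0, is the mass of the ball. *)
Lemma moment_le (R : realType) (n a : nat) (y lam : expn_le n a -> R) (M : R) :
  moment_cone (@unit_ball R n) y ->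
  (forall x, unit_ball x -> peval (poly_of lam) x <= M) ->
  \sum_al lam al * y al <= M * y bm0.
Proof.
move=> [mu [_ yE]] lamM.
have mX := measurable_unit_ball R n.
have -> : \sum_al lam al * y al =
    \int[mu]_(x in (@unit_ball R n : set (borel_rV R n))) peval (poly_of lam) x.
  rewrite /poly_of; under [RHS]eq_Rintegral do rewrite peval_sum.
  elim: (index_enum _) => [|al r IHr].
    under [RHS]eq_Rintegral do rewrite big_nil.
    by rewrite big_nil Rintegral_cst // mul0r.
  under [RHS]eq_Rintegral do rewrite big_cons -peval_sum pevalZ.
  rewrite big_cons RintegralD //.
  - rewrite RintegralZl // -?yE; last exact: peval_integrable.
    by congr (_ + _); rewrite IHr; apply: eq_Rintegral => x _; rewrite peval_sum.
  - under eq_fun do rewrite /= -pevalZ; exact: peval_integrable.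
  - exact: peval_integrable.
have -> : M * y bm0 =
    \int[mu]_(x in (@unit_ball R n : set (borel_rV R n))) peval (M *: monom R (@mnm0 n)) x.
  under [RHS]eq_Rintegral do rewrite pevalZ.
  by rewrite RintegralZl // ?yE //; exact: peval_integrable.
apply: le_Rintegral => //; try exact: peval_integrable.
move=> x xX; apply: le_trans (lamM x xX) _.
by rewrite pevalZ /peval mevalX big1 ?mulr1 // => i _; rewrite mnm0E expr0.
Qed.

Lemma moment_cone0 (R : realType) (n a : nat) :
  moment_cone (a := a) (@unit_ball R n) (fun=> 0).
Proof.
exists (@mzero _ (borel_rV R n) R); split => // al.
by rewrite /Rintegral integral_measure_zero.
Qed.

Lemma moment_cone_dirac (R : realType) (n a : nat) (x : 'rV[R]_n) :
  unit_ball x ->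
  moment_cone (a := a) (@unit_ball R n) (fun al => peval (monom R al) x).
Proof.
move=> xX; have mX := measurable_unit_ball R n.
exists (@dirac _ (borel_rV R n) x R); split => [|al].
  by rewrite /= diracE memNset //= => /(_ xX).
rewrite /Rintegral integral_dirac //; last first.
  by apply/measurable_EFinP; exact: measurable_peval.
by rewrite diracE mem_set //= mul1r.
Qed.

(** Interpolation writes [y] as a linear combination of moment vectors of Dirac measures at the
    nodes. The zero measure takes up the weight that makes the coefficients sum to 1. *)
Lemma affine_hull_moment_cone (R : realType) (n a : nat)
    (y : expn_le n a -> R^o) :
  affine_hull (moment_cone (@unit_ball R n) : set (expn_le n a -> R^o)) y.
Proof.
have [K [x [c [xX cP]]]] := interpolation R n a.
(* The linear form sending each monomial of exponent [al] to [y al] is the combination of the node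
   evaluations with weights [b]. *)
pose b k := \sum_(al : expn_le n a) y al * c al k.
pose C i := if unlift ord0 i is Some j then b (enum_val (A := K) j)
  else 1 - \sum_k b k.
pose V i : expn_le n a -> R^o := if unlift ord0 i is Some j
  then fun al => peval (monom R al) (x (enum_val (A := K) j)) else fun=> 0.
exists #|K|.+1, C, V; split.
- move=> i; rewrite /V; case: (unlift _ _) => [k|]; last exact: moment_cone0.
  apply: moment_cone_dirac; rewrite /unit_ball /= subr_ge0.
  by apply: le_trans (xX _) _; rewrite invf_le1 // ler1n.
- rewrite big_ord_recl /C unlift_none.
  under [X in _ + X]eq_bigr do rewrite liftK.
  rewrite -(big_enum_val b) /=; under [X in _ + X]eq_bigl do rewrite inE.
  by rewrite subrK.
- apply/funext => be; rewrite big_ord_recl /C /V unlift_none.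
  under [X in _ + X]eq_bigr do rewrite liftK.
  rewrite fctE fct_sumE /= scaler0 add0r.
  rewrite -(big_enum_val (fun k => b k * peval (monom R be) (x k))) /=.
  under [RHS]eq_bigl do rewrite inE.
  have dual al : \sum_k c (bmnm al) k * peval (monom R be) (x k) = (be == al)%:R.
    apply: etrans (esym (cP (monom R be) al _ _)) _; last by rewrite mcoeffX.
      by rewrite mmeasureX; exact: bmdeg.
    by rewrite -ltnS; exact: bmdeg.
  under [RHS]eq_bigr do rewrite /b mulr_suml.
  rewrite exchange_big /=.
  under eq_bigr => al _.
    under eq_bigr do rewrite -mulrA.
    rewrite -mulr_sumr dual.
    over.
  rewrite (bigD1 be) //= eqxx mulr1 big1 ?addr0 // => al.
  by rewrite eq_sym => /negPf ->; rewrite mulr0.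
Qed.

Lemma ptws_cvg (J S : Type) (T : topologicalType) (F : set_system S)
    (g : S -> {ptws J -> T}) (z : {ptws J -> T}) :
  Filter F -> (forall j, g s j @[s --> F] --> z j) -> g s @[s --> F] --> z.
Proof.
move=> FF gz; apply/cvg_sup => j U [_ [[W oW <-] Wz WU]].
apply: filterS WU _; apply: gz.
exact: open_nbhs_nbhs.
Qed.

(** The affine hull is the whole space, so the cone contains every point near [z], in particular z +
    r e for small r > 0. *)
Lemma relative_interior_shift (R : realType) (n a : nat)
    (z : expn_le n a -> R^o) (e : expn_le n a -> R^o) :
  relative_interior (moment_cone (@unit_ball R n)) z ->
  exists2 r : R, 0 < r & moment_cone (@unit_ball R n) (fun al => z al + r * e al).
Proof.
move=> [_ zK].
have cvgz : ((fun r al => z al + r * e al) : R -> {ptws expn_le n a -> R})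
    @ 0^'+ --> (z : {ptws expn_le n a -> R}).
  apply: ptws_cvg => al.
  rewrite -[X in _ --> X]addr0 -[X in _ --> _ + X](mul0r (e al)).
  apply: cvgD; first exact: cvg_cst.
  apply: cvgM; last exact: cvg_cst.
  exact/cvg_at_right_filter/cvg_id.
have /(filterI (nbhs_right_gt 0))/filter_ex[r [r0 rK]] := cvgz _ zK.
exists r; first exact: r0.
by apply: rK; exact: affine_hull_moment_cone.
Qed.

Lemma feasible_bounded (R : realType) (n a : nat) (z : expn_le n a -> R^o)
    (M : R) :
  relative_interior (moment_cone (@unit_ball R n)) z ->
  exists B : R, forall lam : expn_le n a -> R,
    (forall x, unit_ball x -> peval (poly_of lam) x <= M) ->
    0 <= \sum_al lam al * z al -> forall al, `|lam al| <= B.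
Proof.
move=> zK.
pose e (s : bool) (al be : expn_le n a) : R^o := (-1) ^+ s * (al == be)%:R.
have step (s : bool) al : exists B : R, forall lam : expn_le n a -> R,
    (forall x, unit_ball x -> peval (poly_of lam) x <= M) ->
    0 <= \sum_al lam al * z al -> (-1) ^+ s * lam al <= B.
  have [r r0 rK] := relative_interior_shift _ _ _ _ (e s al) zK.
  exists (M * (z bm0 + r * e s al bm0) / r) => lam lamM lamz.
  rewrite ler_pdivlMr //.
  apply: le_trans (moment_le _ _ _ _ _ _ rK lamM).
  under eq_bigr do rewrite mulrDr.
  rewrite big_split /= ler_wpDl // (bigD1 al) //= big1 ?addr0.
    by rewrite /e eqxx mulr1; lra.
  by move=> be; rewrite eq_sym /e => /negPf ->; rewrite !mulr0.
(* There are finitely many signed directions, so the sum of the absolute bounds serves for all of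
   them. *)
have [B BP] := choice (fun sal : bool * expn_le n a => step sal.1 sal.2).
exists (\sum_sal `|B sal|) => lam lamM lamz al.
have le_sum sal : B sal <= \sum_sal `|B sal|.
  rewrite (bigD1 sal) //= ler_wpDr ?ler_norm ?sumr_ge0 //.
have := BP (false, al) lam lamM lamz; have := BP (true, al) lam lamM lamz.
rewrite /= expr0 expr1 mul1r mulN1r => h1 h2.
by rewrite ler_norml lerNl (le_trans h1) ?(le_trans h2).
Qed.

(** * Polynomials as coefficient families *)

Lemma mcoeff_poly_of (R : realType) (n a : nat) (lam : expn_le n a -> R)
    (al : expn_le n a) :
  mcoeff al (poly_of lam) = lam al.
Proof.
rewrite /poly_of raddf_sum /= (bigD1 al) //= mcoeffZ mcoeffX eqxx mulr1.
rewrite big1 ?addr0 // => be beal.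
by rewrite mcoeffZ mcoeffX -bmeqP (negPf beal) mulr0.
Qed.

Lemma msize_poly_of (R : realType) (n a : nat) (lam : expn_le n a -> R) :
  (mmeasure (@mdeg n) (poly_of lam) <= a.+1)%N.
Proof.
apply: leq_trans (mmeasure_sum _ _ _ _) _; apply/bigmax_leqP => al _.
by apply: leq_trans (msizeZ_le _ _) _; rewrite mmeasureX bmdeg.
Qed.

Lemma poly_of_mcoeff (R : realType) (n a : nat) (p : mpoly n R) :
  (mmeasure (@mdeg n) p <= a.+1)%N ->
  poly_of (fun al : expn_le n a => mcoeff al p) = p.
Proof.
move=> pa; apply/mpolyP => m; have [ma|am] := ltnP (mdeg m) a.+1.
  exact: (mcoeff_poly_of _ _ _ _ (BMultinom ma)).
rewrite !memN_msupp_eq0 // msize_mdeg_ge // (leq_trans _ am) //.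
exact: msize_poly_of.
Qed.

Lemma peval_poly_of (R : realType) (n a : nat) (lam : expn_le n a -> R)
    (x : 'rV[R]_n) :
  peval (poly_of lam) x = \sum_al lam al * peval (monom R al) x.
Proof. by rewrite peval_sum; apply: eq_bigr => al _; rewrite pevalZ. Qed.

Lemma apolar_poly_of (R : realType) (n a : nat) (f : mpoly n R)
    (lam : expn_le n a -> R) :
  apolar a f (poly_of lam) = \sum_al lam al * apolar a f (monom R al).
Proof.
apply: eq_bigr => al _; rewrite mcoeff_poly_of mulrC; congr (_ * _).
rewrite /apolar (bigD1 al) //= mcoeffX eqxx mulr1 big1 ?addr0 // => be beal.
by rewrite mcoeffX -bmeqP eq_sym (negPf beal) mulr0.
Qed.

(** Interpolation recovers each coefficient of the difference from its values. This turns a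
    polynomial identity into a family of pointwise, closed conditions. *)
Lemma mpoly_eq_peval (R : realType) (n : nat) (p q : mpoly n R) :
  (forall x, peval p x = peval q x) -> p = q.
Proof.
move=> pq; apply/eqP; rewrite -subr_eq0; apply/eqP/mpolyP => m.
set d := maxn (mmeasure (@mdeg n) (p - q)) (mdeg m).
have [K [x [c [_ cP]]]] := interpolation R n d.
rewrite (cP _ m) ?leq_maxr // 1?leqW ?leq_maxl // mcoeff0.
by apply: big1 => k _; rewrite /peval mevalB -/(peval p _) pq subrr mulr0.
Qed.

(** Coefficients are fixed linear combinations of node values, and the nodes lie in the ball of
    radius 1/2; the bound involves only [N] at the nodes, hence is uniform in [q]. *)
Lemma coef_bounded (R : realType) (n d : nat) (N : 'rV[R]_n -> R) :
  exists2 B : R, 0 <= B & forall q : expn_le n d -> R,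
    (forall x : 'rV[R]_n, \sum_i x ord0 i ^+ 2 <= 4^-1 ->
      `|peval (poly_of q) x| <= N x) ->
    forall be, `|q be| <= B.
Proof.
have [K [x [c [xX cP]]]] := interpolation R n d.
exists (\sum_(be : expn_le n d) \sum_k `|c be k * N (x k)|) => [|q qN be].
  by apply: sumr_ge0 => be _; apply: sumr_ge0.
have bed : (mdeg be <= d)%N by rewrite -ltnS; exact: bmdeg.
have -> : q be = \sum_k c be k * peval (poly_of q) (x k).
  exact: etrans (esym (mcoeff_poly_of _ _ _ q be)) (cP _ be (msize_poly_of _ _ _ q) bed).
apply: le_trans (ler_norm_sum _ _ _) _.
rewrite (bigD1 be) //= ler_wpDr ?sumr_ge0 //.
  by move=> al _; apply: sumr_ge0.
apply: ler_sum => k _; rewrite !normrM ler_wpM2l //.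
by rewrite (le_trans (qN _ (xX k))) // ler_norm.
Qed.

(** Fixing both the number of squares and the degree of each makes the certificates a family with
    finitely many real parameters. *)
Lemma sos_leP (R : realType) (n t : nat) (p : mpoly n R) :
  sos_le (2 * t) p <->
  exists g : 'I_#|{: expn_le n (2 * t)}| -> expn_le n t -> R,
    p = \sum_i poly_of (g i) ^+ 2.
Proof.
split=> [[[s ps] pt]|[g pg]].
  have pE : p = \sum_(i < size s) tnth (in_tuple s) i ^+ 2.
    by rewrite ps big_tnth.
  have [|g [gt fg]] := sumsq_caratheodory R n t _ (tnth (in_tuple s)).
    (* [pdeg] is a predecessor, so size 0 is treated apart from positive size. *)
    apply: msize_sumsq; rewrite -pE; move: pt; rewrite /pdeg.
    by case: (mmeasure _ _).
  exists (fun i be => mcoeff be (g i)); rewrite pE fg.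
  by apply: eq_bigr => i _; rewrite poly_of_mcoeff.
split.
  by exists [seq poly_of (g i) | i <- index_enum _]; rewrite big_map.
rewrite /pdeg -subn1 leq_subLR add1n pg.
apply: leq_trans (mmeasure_sum _ _ _ _) _; apply/bigmax_leqP => i _.
rewrite expr2; apply: leq_trans (msize_mul _ _ _ _) _.
by move: (mmeasure _ _) (msize_poly_of R n t (g i)) => k kt; lia.
Qed.

(** * Attainment by compactness *)

Lemma sup_attained_max (R : realType) (T : Type) (F : set T) (f : T -> R) (l : T) :
  F l -> (forall l', F l' -> f l' <= f l) -> sup_attained F f.
Proof.
move=> Fl lmax; exists l => //; apply/eqP; rewrite eq_le; apply/andP; split.
  by apply: ereal_sup_ubound; exists l.
by apply: ge_ereal_sup => _ [l' Fl' <-]; rewrite lee_fin lmax.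
Qed.

Lemma closed_bounded_max (R : realType) (J : finType) (C : set {ptws J -> R})
    (f : {ptws J -> R} -> R) (B : R) :
  closed C -> (forall w, C w -> forall j, `|w j| <= B) -> C !=set0 ->
  continuous f -> exists2 c, C c & forall w, C w -> f w <= f c.
Proof.
move=> Ccl CB C0 fc.
have Cco : compact C.
  apply: (subclosed_compact Ccl (tychonoff (fun=> @segment_compact R (- B) B))).
  by move=> w Cw j; rewrite /= in_itv /= -ler_norml CB.
have [|c /set_mem Cc cmax] := @compact_EVT_max _ R f C C0 Cco.
  exact: continuous_subspaceT.
by exists c => // w /mem_set /cmax.
Qed.

(** [C] is a compact lift of the feasible points of nonnegative value, [J] indexing the lifted
    coordinates and [h] selecting those of the original variable. Feasible points of negative value
    cannot beat the given one of nonnegative value. *)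
Lemma sup_attained_compact (R : realType) (J T : finType) (h : T -> J)
    (F : set (T -> R)) (f : (T -> R) -> R) (C : set {ptws J -> R}) (B : R) :
  closed C -> (forall w, C w -> forall j, `|w j| <= B) ->
  continuous (fun w : {ptws J -> R} => f (w \o h)) ->
  (forall l, F l -> 0 <= f l -> exists2 w, C w & w \o h = l) ->
  (forall w, C w -> F (w \o h)) ->
  (exists2 l, F l & 0 <= f l) ->
  sup_attained F f.
Proof.
move=> Ccl CB fc FC CF [l0 Fl0 l0_ge0].
have [w0 Cw0 w0l0] := FC _ Fl0 l0_ge0.
have [|c Cc cmax] := closed_bounded_max _ _ _ _ _ Ccl CB _ fc; first by exists w0.
apply: (sup_attained_max _ _ _ _ (c \o h)) => [|l Fl]; first exact: CF.
have [l_ge0|/ltW l_le0] := lerP 0 (f l).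
  by have [w Cw <-] := FC _ Fl l_ge0; exact: cmax.
by apply: le_trans l_le0 (le_trans l0_ge0 _); rewrite -w0l0 cmax.
Qed.

Lemma continuous_linear_coords (R : realType) (J T : finType) (h : T -> J)
    (c : T -> R) :
  continuous (fun w : {ptws J -> R} => \sum_al (w \o h) al * c al).
Proof.
apply: continuous_big => [|al _]; first exact: add_continuous.
have pc : continuous (fun w : {ptws J -> R} => w (h al)).
  exact: (@proj_continuous J (fun=> R) (h al)).
by move=> w; exact: (cvgM (pc w) (@cvg_cst _ _ _ _ _)).
Qed.

Lemma continuous_peval_coords (R : realType) (J : finType) (n a : nat)
    (h : expn_le n a -> J) (x : 'rV[R]_n) :
  continuous (fun w : {ptws J -> R} => peval (poly_of (w \o h)) x).
Proof.
have -> : (fun w : {ptws J -> R} => peval (poly_of (w \o h)) x) =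
    fun w => \sum_al (w \o h) al * peval (monom R al) x.
  by apply/funext => w; exact: peval_poly_of.
exact: continuous_linear_coords.
Qed.

(** * The two programs *)

Lemma feasible_norm_le (R : realType) (n a : nat) (z : expn_le n a -> R^o)
    (Psi : mpoly n R) :
  relative_interior (moment_cone (@unit_ball R n)) z ->
  exists2 B : R, 0 <= B & forall lam : expn_le n a -> R,
    (forall x, unit_ball x -> 0 <= peval (Psi - poly_of lam) x) ->
    0 <= \sum_al lam al * z al -> forall al, `|lam al| <= B.
Proof.
move=> zK; have [M _ PsiM] := peval_bounded R n Psi.
have [B BP] := feasible_bounded R n a z M zK.
exists `|B| => // lam lamP lamz al; apply: le_trans (ler_norm B).
apply: BP => // x xX; apply: le_trans (le_trans (ler_norm _) (PsiM x xX)).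
by rewrite -subr_ge0 -pevalB; exact: lamP.
Qed.

Lemma poly_of0 (R : realType) (n a : nat) :
  poly_of (fun _ : expn_le n a => 0 : R) = 0.
Proof. by rewrite /poly_of big1 // => al _; rewrite scale0r. Qed.

Lemma sos_ge0 (R : realType) (n : nat) (p : mpoly n R) x :
  is_sos p -> 0 <= peval p x.
Proof.
move=> [s ->]; rewrite peval_sumsq; apply: sumr_ge0 => q _; exact: sqr_ge0.
Qed.

Lemma moment_dual_attained (R : realType) (n a : nat) (z : expn_le n a -> R^o)
    (Psi : mpoly n R) :
  is_sos Psi ->
  relative_interior (moment_cone (@unit_ball R n)) z ->
  sup_attained
    [set lam : expn_le n a -> R |
      forall x, unit_ball x -> 0 <= peval (Psi - poly_of lam) x]
    (fun lam => \sum_al lam al * z al).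
Proof.
move=> PsiS zK; have [B _ BP] := feasible_norm_le _ _ _ _ Psi zK.
have feasE (lam : expn_le n a -> R) x :
    0 <= peval (Psi - poly_of lam) x <-> peval (poly_of lam) x <= peval Psi x.
  by rewrite pevalB subr_ge0.
(* Here no lifting takes place; [\o id] only matches the shape of [sup_attained_compact]. *)
pose C : set {ptws expn_le n a -> R} :=
  [set lam : _ -> R | forall x, unit_ball x ->
    peval (poly_of (lam \o id)) x <= peval Psi x] `&`
  [set lam : _ -> R | 0 <= \sum_al (lam \o id) al * z al].
apply: (sup_attained_compact R _ _ id _ _ C B).
- apply: closedI.
    apply: closed_bigI => x _.
    apply: (@closed_comp _ _ (fun lam : {ptws expn_le n a -> R} =>
      peval (poly_of (lam \o id)) x) [set r | r <= peval Psi x]) => [lam _|];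
      last exact: closed_le.
    exact: continuous_peval_coords.
  apply: (@closed_comp _ _ (fun lam : {ptws expn_le n a -> R} => _)
    [set r : R | 0 <= r]) => [lam _|]; last exact: closed_ge.
  exact: (continuous_linear_coords R _ _ id z).
- by move=> lam [lamP lamz]; apply: BP => // x xX; exact/feasE/lamP.
- exact: continuous_linear_coords.
- by move=> lam lamP lamz; exists lam => //; split => // x xX; exact/feasE/lamP.
- by move=> lam [lamP _] x xX; exact/feasE/lamP.
- exists (fun=> 0); last by rewrite big1 // => al _; rewrite mul0r.
  by move=> x _; rewrite poly_of0 subr0; exact: sos_ge0.
Qed.

Lemma sos_relaxation_attained (R : realType) (n a t : nat)
    (z : expn_le n a -> R^o) (Psi : mpoly n R) :
  sos_le (2 * t) Psi ->
  relative_interior (moment_cone (@unit_ball R n)) z ->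
  sup_attained
    [set lam : expn_le n a -> R |
        exists sigma0 sigma1 : mpoly n R,
          [/\ sos_le (2 * t) sigma0, sos_le (2 * (t - 1)) sigma1 &
              Psi - poly_of lam = sigma0 + sigma1 * ball_poly R n]]
    (fun lam => \sum_al lam al * z al).
Proof.
move=> PsiS zK; have [B B0 BP] := feasible_norm_le _ _ _ _ Psi zK.
set D := #|{: expn_le n (2 * t)}|; set E := #|{: expn_le n (2 * (t - 1))}|.
(* The lifted coordinates are [lam], then the coefficients of the [D] polynomials squared in sigma_0
   and of the [E] polynomials squared in sigma_1. *)
pose J : finType := (expn_le n a + ('I_D * expn_le n t + 'I_E * expn_le n (t - 1)))%type.
pose h (al : expn_le n a) : J := inl al.
pose h0 (i : 'I_D) (al : expn_le n t) : J := inr (inl (i, al)).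
pose h1 (i : 'I_E) (al : expn_le n (t - 1)) : J := inr (inr (i, al)).
pose S (w : J -> R) x := \sum_i peval (poly_of (w \o h0 i)) x ^+ 2 +
  (\sum_i peval (poly_of (w \o h1 i)) x ^+ 2) * peval (ball_poly R n) x.
pose C : set {ptws J -> R} :=
  [set w : _ -> R | forall x, peval (poly_of (w \o h)) x + S w x = peval Psi x] `&`
  [set w : _ -> R | 0 <= \sum_al (w \o h) al * z al].
have CE w x : C w -> peval (Psi - poly_of (w \o h)) x = S w x.
  by move=> [wP _]; rewrite pevalB -wP addrC addKr.
have sq_sum k (g : 'I_k -> R) : 0 <= \sum_i g i ^+ 2.
  by apply: sumr_ge0 => j _; exact: sqr_ge0.
have CX w x : C w -> unit_ball x -> 0 <= peval (Psi - poly_of (w \o h)) x.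
  move=> Cw xX; rewrite CE //; apply: addr_ge0; first exact: sq_sum.
  by apply: mulr_ge0; [exact: sq_sum|rewrite peval_ball_poly].
have CB w al : C w -> `|w (h al)| <= B.
  by move=> Cw; apply: (BP (w \o h)) => [x|]; [exact: CX|exact: Cw.2].
(* On the ball of radius 1/2 the factor 2 makes up for the multiplier 1 - |x|^2, which is at least
   1/2 there, so each single square is at most 2 S; the summand 1 comes from |r| <= r^2 + 1. *)
pose N (x : 'rV[R]_n) :=
  1 + 2 * (`|peval Psi x| + \sum_(al : expn_le n a) B * `|peval (monom R al) x|).
have CN w x : C w -> 2 * S w x + 1 <= N x.
  move=> Cw; rewrite /N addrC lerD2l ler_wpM2l // -CE // pevalB.
  rewrite lerD ?ler_norm //; apply: le_trans (ler_norm _) _; rewrite normrN.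
  rewrite peval_poly_of; apply: le_trans (ler_norm_sum _ _ _) _.
  apply: ler_sum => al _; rewrite normrM ler_wpM2r //; exact: CB.
have ballE (x : 'rV[R]_n) : \sum_i x ord0 i ^+ 2 <= 4^-1 ->
    1 <= 2 * peval (ball_poly R n) x.
  by move=> x4; rewrite peval_ball_poly; lra.
have [B0' B0'0 B0P] := coef_bounded R n t N.
have [B1' B1'0 B1P] := coef_bounded R n (t - 1) N.
have sq_term k (g : 'I_k -> R) i : g i ^+ 2 <= \sum_i g i ^+ 2.
  by rewrite (bigD1 i) //= ler_wpDr // sumr_ge0 // => j _; exact: sqr_ge0.
have norm_sq (r : R) : `|r| <= r ^+ 2 + 1.
  by rewrite ler_norml; apply/andP; split; nra.
have CB0 w i be : C w -> `|w (h0 i be)| <= B0'.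
  move=> Cw; apply: (B0P (w \o h0 i)) => x x4.
  apply: le_trans (CN _ x Cw); apply: le_trans (norm_sq _) _.
  have := sq_term _ (fun i => peval (poly_of (w \o h0 i)) x) i.
  have := sq_sum _ (fun i => peval (poly_of (w \o h1 i)) x).
  have := sqr_ge0 (peval (poly_of (w \o h0 i)) x).
  have := ballE _ x4; rewrite /S /=; nra.
have CB1 w i be : C w -> `|w (h1 i be)| <= B1'.
  move=> Cw; apply: (B1P (w \o h1 i)) => x x4.
  apply: le_trans (CN _ x Cw); apply: le_trans (norm_sq _) _.
  have := sq_term _ (fun i => peval (poly_of (w \o h1 i)) x) i.
  have := sq_sum _ (fun i => peval (poly_of (w \o h0 i)) x).
  have := sq_sum _ (fun i => peval (poly_of (w \o h1 i)) x).
  have := ballE _ x4; rewrite /S /=; nra.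
have Scont k (g : 'I_k -> {ptws J -> R} -> R) : (forall i, continuous (g i)) ->
    continuous (fun w => \sum_i g i w ^+ 2).
  move=> gc; apply: continuous_big => [|i _]; first exact: add_continuous.
  by move=> w; apply: continuous_comp (gc i w) (@exprn_continuous R 2 _).
apply: (sup_attained_compact R _ _ h _ _ C (B + B0' + B1')).
- apply: closedI.
    (* The identity is imposed at each point separately, which exhibits [C] as an intersection of
       closed sets. *)
    rewrite (_ : mkset _ = \bigcap_(x in [set: 'rV[R]_n])
        [set w : _ -> R | peval (poly_of (w \o h)) x + S w x = peval Psi x]).
      apply: closed_bigI => x _.
      apply: (@closed_comp _ _ (fun w : {ptws J -> R} =>
          peval (poly_of (w \o h)) x + S w x) [set r : R | r = peval Psi x]) => [w _|];
        last exact: closed_eq.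
      have c0 := Scont _ _ (fun i => continuous_peval_coords R J n t (h0 i) x).
      have c1 := Scont _ _ (fun i => continuous_peval_coords R J n (t - 1) (h1 i) x).
      exact: (cvgD (continuous_peval_coords R J n a h x w)
        (cvgD (c0 w) (cvgM (c1 w) (@cvg_cst _ _ _ _ _)))).
    by apply/seteqP; split=> w /= wP x => [_|]; exact: wP.
  apply: (@closed_comp _ _ (fun w : {ptws J -> R} => _)
    [set r : R | 0 <= r]) => [w _|]; last exact: closed_ge.
  exact: (continuous_linear_coords R _ _ h z).
- move=> w Cw [al|[[i be]|[i be]]].
  + by rewrite -addrA ler_wpDr ?addr_ge0 //; exact: CB.
  + by rewrite addrAC ler_wpDl ?addr_ge0 //; exact: CB0.
  + by rewrite ler_wpDl ?addr_ge0 //; exact: CB1.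
- exact: continuous_linear_coords.
- move=> lam [s0 [s1 [/sos_leP[g0 s0E] /sos_leP[g1 s1E] lamE]]] lamz.
  pose w (j : J) : R := match j with
    | inl al => lam al
    | inr (inl (i, be)) => g0 i be
    | inr (inr (i, be)) => g1 i be end.
  exists w => //; split => // x.
  rewrite -[RHS](subrK (peval (poly_of lam) x)) -pevalB lamE addrC; congr (_ + _).
  by rewrite pevalD pevalM s0E s1E !peval_sumsq.
- move=> w Cw.
  exists (\sum_i poly_of (w \o h0 i) ^+ 2), (\sum_i poly_of (w \o h1 i) ^+ 2).
  split.
  + by apply/sos_leP; exists (fun i => w \o h0 i).
  + by apply/sos_leP; exists (fun i => w \o h1 i).
  + apply: mpoly_eq_peval => x.
    by rewrite CE // pevalD pevalM !peval_sumsq.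
- exists (fun=> 0); last by rewrite big1 // => al _; rewrite mul0r.
  (* At lambda = 0, [Psi] is its own certificate. *)
  exists Psi, 0; split => //; last by rewrite poly_of0 subr0 mul0r addr0.
  by split; [exists [::]; rewrite big_nil|rewrite /pdeg mmeasure0].
Qed.

Theorem corollary6p3 (R : realType) (n a : nat) (A : tensor R n a)
    (Psi : mpoly n R) :
  symmetric_tensor A ->
  A [ffun=> ord_max] != 0 ->
  is_sos Psi ->
  relative_interior (moment_cone (a := a) (@unit_ball R n))
    (fun alpha => apolar a (tensor_poly A) (monom R alpha)) ->
  sup_attained
    [set lambda : expn_le n a -> R |
      forall x, unit_ball x -> 0 <= peval (Psi - poly_of lambda) x]
    (fun lambda => apolar a (tensor_poly A) (poly_of lambda))
  /\
  forall t : nat,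
    (maxn 1 (maxn (uphalf a) (uphalf (pdeg Psi))) <= t)%N ->
    sup_attained
      [set lambda : expn_le n a -> R |
        exists sigma0 sigma1 : mpoly n R,
          [/\ sos_le (2 * t) sigma0, sos_le (2 * (t - 1)) sigma1 &
              Psi - poly_of lambda = sigma0 + sigma1 * ball_poly R n]]
      (fun lambda => apolar a (tensor_poly A) (poly_of lambda)).
Proof.
move=> _ _ PsiS zK.
(* The objective is the linear form whose coefficients are the given moment sequence. *)
have -> : (fun lambda => apolar a (tensor_poly A) (poly_of lambda)) =
    fun lambda : expn_le n a -> R =>
      \sum_al lambda al * apolar a (tensor_poly A) (monom R al).
  by apply/funext => lambda; exact: apolar_poly_of.
split=> [|t tP]; first exact: moment_dual_attained.
apply: sos_relaxation_attained => //; split => //.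
(* The bound on [t] gives deg Psi <= 2t, so [Psi] can serve as sigma_0. *)
move: tP; rewrite !geq_max => /and3P[_ _].
by rewrite leq_uphalf_double mul2n.
Qed.
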